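(* Let $p>q>1$ be relatively prime integers. Then the map $F_{p,q}:A_{pq}^{\mathbb{Z}}\to A_{pq}^{\mathbb{Z}}$ is measure preserving and strongly mixing with respect to $\mu$, i.e. $\mu(F_{p,q}^{-1}(S))=\mu(S)$ for every Borel set $S$, and $\lim_{t\to\infty}\mu(F_{p,q}^{-t}(U)\cap V)=\mu(U)\mu(V)$ for all Borel sets $U,V\subseteq A_{pq}^{\mathbb{Z}}$.
   Context: For an integer $n>1$, $A_n=\{0,1,\dots,n-1\}$. $A_{pq}^{\mathbb{Z}}$ carries the product topology, and $\mu$ is the uniform Bernoulli (product) probability measure on its Borel sets, i.e. $\mu(\{c \mid c(i)c(i+1)\cdots c(i+|w|-1)=w\})=(pq)^{-|w|}$ for every nonempty word $w$ over $A_{pq}$ and $i\in\mathbb{Z}$. Define $g_{p,q}:A_{pq}\times A_{pq}\to A_{pq}$ by writing $x=x_1q+x_0$, $y=y_1q+y_0$ with $x_0,y_0\in A_q$, $x_1,y_1\in A_p$ (uniquely), and setting $g_{p,q}(x,y)=x_0p+y_1$. Then $F_{p,q}(c)(i)=g_{p,q}\big(g_{p,q}(c(i-1),c(i)),\,g_{p,q}(c(i),c(i+1))\big)$ for $c\in A_{pq}^{\mathbb{Z}}$, $i\in\mathbb{Z}$. *)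

(* Defs.v *)
From HB Require Import structures.
From mathcomp Require Import all_boot all_order all_algebra.
From mathcomp Require Import all_classical all_reals all_analysis.
Set Implicit Arguments. Unset Strict Implicit. Unset Printing Implicit Defensive.
Import Order.TTheory GRing.Theory Num.Theory.
Local Open Scope classical_set_scope.
Local Open Scope ring_scope.

(* The alphabet A_{m+1} = {0,...,m}; in the theorem m+1 = p*q, i.e. the
   alphabet is 'I_((p*q).-1.+1) = {0,...,pq-1}.  (The successor form is needed
   because MathComp-Analysis measurable spaces must be pointed types.) *)
Definition alphabet (m : nat) : Type := 'I_m.+1.
HB.instance Definition _ m := Finite.on (alphabet m).
HB.instance Definition _ m := isPointed.Build (alphabet m) (@ord0 m).

Definition dalpha (m : nat) := discrete_topology (alphabet m).
HB.instance Definition _ m := Pointed.on (dalpha m).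
HB.instance Definition _ m := Topological.on (dalpha m).

Definition conf (m : nat) : Type := prod_topology (fun _ : int => dalpha m).
HB.instance Definition _ m := Pointed.copy (conf m) (forall _ : int, dalpha m).
HB.instance Definition _ m := Topological.on (conf m).

Definition borel_conf (m : nat) := g_sigma_algebraType (@open (conf m)).
HB.instance Definition _ m := Measurable.on (borel_conf m).

Definition cylinder (m : nat) (i : int) (w : seq (alphabet m)) : set (borel_conf m) :=
  [set c | forall k : nat, (k < size w)%N -> c (i + k%:Z) = nth (c i) w k].

Definition uniform_bernoulli (R : realType) (m : nat)
    (mu : set (borel_conf m) -> \bar R) : Prop :=
  forall (i : int) (w : seq (alphabet m)), w != [::] ->
    mu (cylinder i w) = ((m.+1%:R : R) ^- size w)%:E.

(* The local rule g_{p,q}: with x = x1 q + x0, y = y1 q + y0,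
   g(x,y) = x0 p + y1.  (The value is always < p q when p, q > 0;
   insubd only supplies a default for the impossible out-of-range case.) *)
Definition g_pq (p q : nat) (x y : alphabet (p * q).-1) : alphabet (p * q).-1 :=
  insubd x ((x %% q) * p + y %/ q)%N.
Arguments g_pq : clear implicits.

Definition F_pq (p q : nat) (c : borel_conf (p * q).-1) : borel_conf (p * q).-1 :=
  fun i : int => g_pq p q (g_pq p q (c (i - 1)) (c i)) (g_pq p q (c i) (c (i + 1))).
Arguments F_pq : clear implicits.

(* Main.v *)
Require Import Defs.
From HB Require Import structures.
From mathcomp Require Import all_boot all_order all_algebra.
From mathcomp Require Import all_classical all_reals all_analysis.
From mathcomp Require Import zify ring lra.
Set Implicit Arguments.
Unset Strict Implicit.
Unset Printing Implicit Defensive.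
Import Order.TTheory GRing.Theory Num.Theory.
Local Open Scope classical_set_scope.
Local Open Scope ring_scope.

(** Write [M = pq] and read the contents of a window as an integer in base [M].
    The map [F_pq] is multiplication by [p/q] in base [M]: the integer in the
    window of [F_pq^t c] starting at [i] with length [k] is
    [(N %/ q ^ (2t)) %% M ^ k], where [N] is the integer of the window of [c]
    enlarged by [t] cells on both sides.  Counting the integers [N] gives
    invariance of the measure on window events.  For mixing, fix all digits of
    [N] except the last [t + O(1)]: then [N] runs over an interval of length
    about [M ^ t], while the event on [F_pq^t c] is periodic in [N] with period
    [q ^ (2t) * M ^ k]; as [p > q] the interval contains about [(p/q) ^ t]
    periods, so the event decorrelates from the fixed digits with error
    [O((q/p) ^ t)].  Window events form a pi-system generating the Borel sets,
    and two applications of Dynkin's lemma extend mixing to all Borel sets. *)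

(** * Counting with periodic functions *)

Lemma sum_nat_blocks (f : nat -> nat) (n k : nat) :
  (\sum_(0 <= a < n * k) f a =
   \sum_(0 <= z < n) \sum_(0 <= b < k) f (z * k + b))%N.
Proof.
rewrite big_nat_mul; apply: eq_bigr => z _.
rewrite mulSn -{1}[(z * k)%N]add0n big_addn addnK.
by apply: eq_bigr => b _; rewrite addnC.
Qed.

Lemma sum_periodic_shift (f : nat -> nat) (d s : nat) :
  (forall a, f (a + d) = f a)%N ->
  (\sum_(0 <= b < d) f (s + b) = \sum_(0 <= b < d) f b)%N.
Proof.
move=> fd; elim: s => // s IH; rewrite -{}IH.
(* With [f s] added, both sides are the sum over the [d.+1] integers from [s] on, split off once at
   the first term and once at the last. *)
apply: (@addnI (f s)); rewrite [RHS]addnC -{2}(fd s) -big_nat_recr//=.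
rewrite big_nat_recl//= addn0; congr addn.
by apply: eq_bigr => b _; rewrite addSnnS.
Qed.

Lemma sum_periodic_mul (f : nat -> nat) (d s n : nat) :
  (forall a, f (a + d) = f a)%N ->
  (\sum_(0 <= b < n * d) f (s + b) = n * \sum_(0 <= b < d) f b)%N.
Proof.
move=> fd; rewrite (sum_nat_blocks (fun b => f (s + b)%N)).
under eq_bigr do (under eq_bigr do rewrite addnA; rewrite sum_periodic_shift//).
by rewrite sum_nat_const_nat subn0.
Qed.

Lemma leq_sum_nat_bound (f : nat -> nat) (m n : nat) : (m <= n)%N ->
  (\sum_(0 <= b < m) f b <= \sum_(0 <= b < n) f b)%N.
Proof. by move=> mn; rewrite [leqRHS](big_cat_nat (n := m))//= leq_addr. Qed.

(** An interval of length [L] contains [L %/ d] disjoint full periods and is covered by one period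
    more. *)
Lemma sum_periodic_bounds (f : nat -> nat) (d s L : nat) : (0 < d)%N ->
  (forall a, f (a + d) = f a)%N ->
  (L %/ d * \sum_(0 <= b < d) f b <= \sum_(0 <= b < L) f (s + b) <=
   (L %/ d).+1 * \sum_(0 <= b < d) f b)%N.
Proof.
move=> d0 fd; rewrite -!(sum_periodic_mul s _ fd).
rewrite !(leq_sum_nat_bound (fun b => f (s + b)%N))//.
- by rewrite ltnW// ltn_ceil.
- by rewrite leq_divM.
Qed.

Lemma sum_mod (f : nat -> nat) (n k : nat) :
  (\sum_(0 <= a < n * k) f (a %% k) = n * \sum_(0 <= a < k) f a)%N.
Proof.
rewrite (@sum_periodic_mul (fun a => f (a %% k)%N) k 0).
  congr muln; apply: eq_big_nat => a /andP[_ ak].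
  by rewrite modn_small.
by move=> a; rewrite modnDr.
Qed.

Lemma sum_divmod (f : nat -> nat) (Q K : nat) :
  (\sum_(0 <= b < K * Q) f (b %/ Q %% K) = Q * \sum_(0 <= a < K) f a)%N.
Proof.
rewrite (sum_nat_blocks (fun b => f (b %/ Q %% K)%N)) big_distrr/=.
apply: eq_big_nat => z /andP[_ zK].
rewrite -[in RHS](subn0 Q) -sum_nat_const_nat; apply: eq_big_nat => b /andP[_ bQ].
by rewrite divnMDl ?(leq_trans _ bQ)// (divn_small bQ) addn0 modn_small.
Qed.

Lemma divmod_periodic (Q K : nat) : (0 < Q)%N ->
  forall a, ((a + K * Q) %/ Q %% K = a %/ Q %% K)%N.
Proof. by move=> Q0 a; rewrite divnDMl// modnDr. Qed.

Lemma sum_divmod_mul (f : nat -> nat) (Q K n : nat) : (0 < Q)%N ->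
  (\sum_(0 <= b < n * (K * Q)) f (b %/ Q %% K) =
   n * (Q * \sum_(0 <= a < K) f a))%N.
Proof.
move=> Q0; rewrite (@sum_periodic_mul (fun b => f (b %/ Q %% K)%N) _ 0).
  by rewrite sum_divmod.
by move=> a; rewrite divmod_periodic.
Qed.

(** Write [N = z * L + b] with [b < L]. The condition on [S] depends on [z] only, while the one on
    [P] has period [K * Q] in [b], so [sum_periodic_bounds] applies to each block of length [L]
    separately. *)
Lemma sum_joint_bounds (P S : pred nat) (Q K L e E : nat) :
  (0 < Q)%N -> (0 < K)%N -> (0 < L)%N ->
  let x := ((Q * \sum_(0 <= a < K) P a) * (e * \sum_(0 <= a < E) S a))%N in
  (L %/ (K * Q) * x <=
   \sum_(0 <= N < e * E * L) (P (N %/ Q %% K) && S (N %/ L %% E)) <=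
   (L %/ (K * Q)).+1 * x)%N.
Proof.
move=> Q0 K0 L0 /=.
rewrite (sum_nat_blocks (fun N => P (N %/ Q %% K)%N && S (N %/ L %% E)%N : nat)).
have -> : (\sum_(0 <= z < e * E) \sum_(0 <= b < L)
    (P ((z * L + b) %/ Q %% K) && S ((z * L + b) %/ L %% E)) =
  \sum_(0 <= z < e * E) S (z %% E) * \sum_(0 <= b < L) P ((z * L + b) %/ Q %% K))%N.
  apply: eq_bigr => z _; rewrite big_distrr/=; apply: eq_big_nat => b /andP[_ bL].
  by rewrite divnMDl// (divn_small bL) addn0 mulnb andbC.
have H z : (L %/ (K * Q) * (Q * \sum_(0 <= a < K) P a) <=
    \sum_(0 <= b < L) P ((z * L + b) %/ Q %% K) <=
    (L %/ (K * Q)).+1 * (Q * \sum_(0 <= a < K) P a))%N.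
  rewrite -(sum_divmod (fun a => P a : nat)).
  apply: (@sum_periodic_bounds (fun b => P (b %/ Q %% K)%N : nat)) => [|a].
    by rewrite muln_gt0 K0 Q0.
  by rewrite divmod_periodic.
set A := (Q * _)%N in H *.
rewrite -(sum_mod (fun a => S a : nat) e E) !(mulnA _ A) !big_distrr/=.
apply/andP; split; apply: leq_sum => z _; have /andP[lo hi] := H z.
- by rewrite mulnC leq_mul.
- by rewrite [leqRHS]mulnC leq_mul.
Qed.

(** Let [m = L %/ (K * Q)] and let [x] be as in [sum_joint_bounds]. Over the denominator
    [e * E * L], the product of the frequencies has numerator [x * L / (K * Q)]. Like the joint
    count, it lies between [m * x] and [(m + 1) * x], so the two differ by at most [x]. *)
Lemma joint_frequency_error (R : realFieldType) (P S : pred nat)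
    (Q K L e E : nat) :
  (0 < Q)%N -> (0 < K)%N -> (0 < L)%N -> (0 < e)%N -> (0 < E)%N ->
  `| (\sum_(0 <= N < e * E * L) (P (N %/ Q %% K)%N && S (N %/ L %% E)%N))%N%:R /
       (e * E * L)%:R
     - ((\sum_(0 <= a < K) P a)%N%:R / K%:R) * ((\sum_(0 <= a < E) S a)%N%:R / E%:R) |
  <= (K * Q)%:R / L%:R :> R.
Proof.
move=> Q0 K0 L0 e0 E0.
have /= := @sum_joint_bounds P S Q K L e E Q0 K0 L0.
have := leq_divM L (K * Q); have : (L < (L %/ (K * Q)).+1 * (K * Q))%N.
  by rewrite ltn_ceil// muln_gt0 K0.
set m := (L %/ _)%N; set N := (\sum_(0 <= i < e * E * L) _)%N.
have : (\sum_(0 <= a < K) P a <= K)%N.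
  rewrite -[leqRHS]muln1 -[K in leqRHS]subn0 -sum_nat_const_nat.
  by apply: leq_sum => a _; case: (P a).
have : (\sum_(0 <= a < E) S a <= E)%N.
  rewrite -[leqRHS]muln1 -[E in leqRHS]subn0 -sum_nat_const_nat.
  by apply: leq_sum => a _; case: (S a).
set sP := (\sum_(0 <= a < K) P a)%N; set sS := (\sum_(0 <= a < E) S a)%N.
move=> sSE sPK /ltnW Lm mL /andP[lo hi].
have K0' : 0 < K%:R :> R by rewrite ltr0n.
have Q0' : 0 < Q%:R :> R by rewrite ltr0n.
have L0' : 0 < L%:R :> R by rewrite ltr0n.
have eEL0 : 0 < (e * E * L)%:R :> R by rewrite ltr0n !muln_gt0 e0 E0.
have E0' : 0 < E%:R :> R by rewrite ltr0n.
set x := (Q * sP * (e * sS))%N in lo hi.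
have -> : sP%:R / K%:R * (sS%:R / E%:R) =
    x%:R / (K * Q)%:R * L%:R / (e * E * L)%:R :> R.
  rewrite /x !natrM; field.
  by rewrite !pnatr_eq0 -!lt0n K0 Q0 L0 e0 E0.
rewrite -mulrBl normrM normfV (gtr0_norm eEL0) ler_pdivrMr//.
(* The claimed error is [K * Q * (e * E)] over [e * E * L], and [x] is at most this numerator. *)
apply: (@le_trans _ _ x%:R); last first.
  have -> : (K * Q)%:R / L%:R * (e * E * L)%:R = (K * Q * (e * E))%:R :> R.
    by rewrite !natrM; field; rewrite gt_eqF.
  by rewrite ler_nat /x (mulnC K); do 2?apply: leq_mul.
have KQ0 : 0 < (K * Q)%:R :> R by rewrite ltr0n muln_gt0 K0.
set y := x%:R / (K * Q)%:R.
have y0 : 0 <= y by rewrite divr_ge0.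
have xE : x%:R = y * (K * Q)%:R by rewrite /y divfK// gt_eqF.
move: lo hi Lm mL; rewrite -!(ler_nat R) !(natrM _ _ x) !(natrM _ _ (K * Q)).
rewrite xE -natr1; set k := (K * Q)%:R => lo hi Lm mL.
have h1 : y * (m%:R * k) <= y * L%:R by rewrite ler_wpM2l.
have h2 : y * L%:R <= y * ((m%:R + 1) * k) by rewrite ler_wpM2l.
by rewrite ler_norml; apply/andP; split; lra.
Qed.

(** * Windows as integers in base [m.+1] *)

Fixpoint window_num (m : nat) (c : borel_conf m) (i : int) (n : nat) : nat :=
  if n is k.+1 then
    (window_num c i k * m.+1 + (c (i + k%:Z)%R : 'I_m.+1))%N
  else 0%N.

Lemma window_numS (m : nat) (c : borel_conf m) (i : int) (n : nat) :
  window_num c i n.+1 =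
  (window_num c i n * m.+1 + (c (i + n%:Z)%R : 'I_m.+1))%N.
Proof. by []. Qed.

Lemma window_num_lt (m : nat) (c : borel_conf m) (i : int) (n : nat) :
  (window_num c i n < m.+1 ^ n)%N.
Proof.
elim: n => [|n IH] /=; first by rewrite expn0.
rewrite expnSr (leq_trans (n := (window_num c i n).+1 * m.+1)%N)//.
  by rewrite mulSn addnC ltn_add2r ltn_ord.
by rewrite leq_mul2r IH.
Qed.

Lemma window_numD (m : nat) (c : borel_conf m) (i : int) (n k : nat) :
  window_num c i (n + k) =
  (window_num c i n * m.+1 ^ k + window_num c (i + n%:Z) k)%N.
Proof.
elim: k => [|k IH]; first by rewrite !addn0 expn0 muln1.
by rewrite addnS /= IH PoszD addrA expnSr mulnDl mulnA addnA.
Qed.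

(** As the leftmost digit is the most significant one, the division drops the [b] cells on the right
    and the remainder drops the [a] cells on the left. *)
Lemma window_num_sub (m : nat) (c : borel_conf m) (i : int) (a k b : nat) :
  window_num c (i + a%:Z) k =
  (window_num c i (a + k + b) %/ m.+1 ^ b %% m.+1 ^ k)%N.
Proof.
rewrite window_numD divnMDl ?expn_gt0// divn_small ?window_num_lt// addn0.
by rewrite window_numD modnMDl modn_small// window_num_lt.
Qed.

Lemma eq_window_num (m : nat) (c c' : borel_conf m) (i i' : int) (n : nat) :
  (forall k : nat, (k < n)%N -> c (i + k%:Z) = c' (i' + k%:Z)) ->
  window_num c i n = window_num c' i' n.
Proof.
elim: n => //= n IH cc'; rewrite IH ?cc'// => k kn.
by apply: cc'; rewrite (ltn_trans kn).
Qed.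

Lemma window_num_inj (m : nat) (c c' : borel_conf m) (i : int) (n : nat) :
  window_num c i n = window_num c' i n ->
  forall k : nat, (k < n)%N -> c (i + k%:Z) = c' (i + k%:Z).
Proof.
elim: n => //= n IH E k; rewrite ltnS leq_eqVlt => /predU1P[->|kn].
  apply/val_inj; move/(congr1 (modn^~ m.+1)): E.
  by rewrite !modnMDl !modn_small ?ltn_ord.
apply: IH kn; move/(congr1 (divn^~ m.+1)): E.
by rewrite !divnMDl// !divn_small ?ltn_ord// !addn0.
Qed.

(** * [F_pq] as multiplication by [p / q] *)

Lemma g_digit_lt (p q x y : nat) : (0 < q)%N -> (y < p * q)%N ->
  (x %% q * p + y %/ q < p * q)%N.
Proof.
move=> q0 ypq; apply: (@leq_trans ((x %% q).+1 * p)%N).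
  by rewrite mulSn addnC ltn_add2r ltn_divLR.
by rewrite mulnC leq_mul2l ltn_mod q0 orbT.
Qed.

Lemma alphabet_lt (p q : nat) (x : 'I_(p * q).-1.+1) :
  (0 < p)%N -> (0 < q)%N -> (x < p * q)%N.
Proof.
by move=> p0 q0; rewrite -[ltnRHS]prednK ?muln_gt0 ?p0// ltn_ord.
Qed.

Lemma g_pqE (p q : nat) (x y : 'I_(p * q).-1.+1) : (0 < p)%N -> (0 < q)%N ->
  (g_pq p q x y : 'I_(p * q).-1.+1) = (x %% q * p + y %/ q)%N :> nat.
Proof.
move=> p0 q0; rewrite /g_pq val_insubd; case: ifPn => // /negP[].
by rewrite [ltnRHS]prednK ?muln_gt0 ?p0// g_digit_lt// alphabet_lt.
Qed.

(** Splitting [W] by division by [q], the quotient on the left becomes [W %/ q * (p * q)] plus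
    [W %% q * p + y %/ q]. The latter is below [p * q], hence a single digit, so the remainder acts
    on [W %/ q] alone. *)
Lemma mul_p_step (p q W y K : nat) : (0 < p)%N -> (0 < q)%N -> (0 < K)%N ->
  (y < p * q)%N ->
  ((W * (p * q) + y) %/ q %% (K * (p * q)) =
   W %/ q %% K * (p * q) + (W %% q * p + y %/ q))%N.
Proof.
move=> p0 q0 K0 ypq; rewrite mulnA divnMDl//.
set r := (W %% q * p + y %/ q)%N.
have rpq : (r < p * q)%N by rewrite g_digit_lt.
have -> : (W * p + y %/ q = W %/ q %/ K * (K * (p * q)) +
    (W %/ q %% K * (p * q) + r))%N.
  rewrite mulnA addnA -mulnDl -divn_eq /r addnA; congr addn.
  by rewrite {1}(divn_eq W q) mulnDl -mulnA (mulnC q).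
rewrite modnMDl modn_small//.
apply: (@leq_trans ((W %/ q %% K).+1 * (p * q))%N).
  by rewrite mulSn addnC ltn_add2r.
by rewrite leq_mul2r ltn_mod K0 orbT.
Qed.

(* In base [pq], multiplication by [p] acts digitwise through [g_pq]. *)
Definition mul_p (p q : nat) (c : borel_conf (p * q).-1) : borel_conf (p * q).-1 :=
  fun i : int => g_pq p q (c i) (c (i + 1)).
Arguments mul_p : clear implicits.

(** Since [p] is the base [p * q] divided by [q], appending a cell on the right and dividing by [q]
    multiplies by [p]; the remainder discards the overflow on the left. *)
Lemma window_num_mul_p (p q : nat) (c : borel_conf (p * q).-1) (i : int) (k : nat) :
  (0 < p)%N -> (0 < q)%N ->
  window_num (mul_p p q c) i k = (window_num c i k.+1 %/ q %% (p * q) ^ k)%N.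
Proof.
move=> p0 q0; have pq0 : (0 < p * q)%N by rewrite muln_gt0 p0.
elim: k => [|k IH]; first by rewrite expn0 modn1.
have S (c' : borel_conf (p * q).-1) n : window_num c' i n.+1 =
    (window_num c' i n * (p * q) + (c' (i + n%:Z)%R : 'I_(p * q).-1.+1))%N.
  by rewrite window_numS [X in (_ * X + _)%N = _]prednK.
rewrite expnSr (S c) mul_p_step ?expn_gt0 ?pq0 ?alphabet_lt//.
rewrite S {}IH /mul_p g_pqE// -addrA -[k%:Z + 1]PoszD addn1.
congr (_ + (_ * p + _))%N.
(* [q] divides the base, so a window is congruent to its last digit modulo [q]. *)
by rewrite S mulnA modnMDl.
Qed.

(** Two multiplications by [p], then a shift by one cell to the right, which divides by [p * q]: in
    total a factor [p / q]. *)
Lemma F_pqE (p q : nat) (c : borel_conf (p * q).-1) (i : int) :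
  F_pq p q c i = mul_p p q (mul_p p q c) (i - 1).
Proof. by rewrite /mul_p subrK. Qed.

Lemma divn_modn_dvd (a d n X : nat) : (n * d %| X)%N ->
  (a %% X %/ d %% n = a %/ d %% n)%N.
Proof. by move=> ndX; rewrite !modn_divl modn_dvdm. Qed.

Lemma window_num_F_pq (p q : nat) (c : borel_conf (p * q).-1) (i : int) (k : nat) :
  (0 < p)%N -> (0 < q)%N ->
  window_num (F_pq p q c) i k =
  (window_num c (i - 1) k.+2 %/ q ^ 2 %% (p * q) ^ k)%N.
Proof.
move=> p0 q0.
rewrite (@eq_window_num _ _ (mul_p p q (mul_p p q c)) i (i - 1)); last first.
  by move=> j _; rewrite F_pqE addrAC.
rewrite !window_num_mul_p// divn_modn_dvd ?divnMA//.
by rewrite expnSr dvdn_mul// dvdn_mull.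
Qed.

Lemma window_num_iter_F_pq (p q : nat) (c : borel_conf (p * q).-1) (i : int)
    (k t : nat) : (0 < p)%N -> (0 < q)%N ->
  window_num (iter t (F_pq p q) c) i k =
  (window_num c (i - t%:Z) (k + t.*2) %/ q ^ t.*2 %% (p * q) ^ k)%N.
Proof.
move=> p0 q0; have pq0 : (0 < p * q)%N by rewrite muln_gt0 p0.
elim: t i k => [|t IH] i k /=.
  rewrite subr0 addn0 expn0 divn1 modn_small// -[X in (_ < X ^ _)%N](prednK pq0).
  exact: window_num_lt.
rewrite window_num_F_pq// IH divn_modn_dvd; last first.
  by rewrite -(addn2 k) expnD dvdn_mul// expnMn dvdn_mull.
by rewrite -divnMA -expnD addn2 -addrA -opprD -[1 + _]PoszD add1n doubleS !addnS !addSn.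
Qed.

(** * Window events generate the Borel sets *)

Lemma measurable_coord (m : nat) (i : int) (a : alphabet m) :
  measurable [set c : borel_conf m | c i = a].
Proof.
apply: sub_gen_smallest => /=.
apply: (@open_comp (conf m) (dalpha m) (fun c => c i) [set a]).
  move=> c _; exact: (@proj_continuous int (fun=> dalpha m) i c).
exact: discrete_open.
Qed.

Lemma measurable_window (m : nat) (i : int) (n : nat) (P : pred nat) :
  measurable [set c : borel_conf m | P (window_num c i n)].
Proof.
have mE a : measurable [set c : borel_conf m | window_num c i n = a].
  elim: n a => [|n IH] a.
    have [->|a0] := eqVneq a 0%N.
      by rewrite (_ : [set _ | _] = setT)//; apply/seteqP.
    rewrite (_ : [set _ | _] = set0)//; apply/seteqP; split => // c /= /esym/eqP.
    by rewrite (negbTE a0).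
  rewrite (_ : [set _ | _] = [set c | window_num c i n = (a %/ m.+1)%N] `&`
     [set c | c (i + n%:Z) = inord (a %% m.+1)]).
    by apply: measurableI => //; exact: measurable_coord.
  apply/seteqP; split => c /=.
    move=> <-; rewrite divnMDl// divn_small ?ltn_ord// addn0 modnMDl modn_small//.
    by rewrite inord_val.
  by move=> [-> ->]; rewrite inordK ?ltn_mod// -divn_eq.
rewrite (_ : [set _ | _] = \bigcup_(a in [set a | P a])
  [set c | window_num c i n = a]).
  by apply: bigcup_measurable => a _.
apply/seteqP; split => [c /= Pc|c [a /= Pa ca]]; last by rewrite /= ca.
by exists (window_num c i n).
Qed.

(** The windows run from cell [-n] to cell [n - 1]. They are nested, so two such events can be read
    off the larger window, which gives a pi-system. *)
Definition window_sets (m : nat) : set (set (borel_conf m)) :=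
  [set A | exists n (P : pred nat),
     A = [set c | P (window_num c (- n%:Z) n.*2)]].

Lemma window_num_central (m : nat) (c : borel_conf m) (n N : nat) : (n <= N)%N ->
  window_num c (- n%:Z) n.*2 =
  (window_num c (- N%:Z) N.*2 %/ m.+1 ^ (N - n) %% m.+1 ^ n.*2)%N.
Proof.
move=> nN; rewrite (_ : - n%:Z = - N%:Z + (N - n)%:Z); last by lia.
by rewrite (@window_num_sub _ c _ _ _ (N - n)); congr (window_num _ _ _ %/ _ %% _)%N; lia.
Qed.

Lemma setI_closed_window_sets (m : nat) : setI_closed (@window_sets m).
Proof.
move=> _ _ [n [P ->]] [n' [P' ->]].
pose N := maxn n n'.
exists N, (fun a => P (a %/ m.+1 ^ (N - n) %% m.+1 ^ n.*2)%N &&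
   P' (a %/ m.+1 ^ (N - n') %% m.+1 ^ n'.*2)%N).
apply/seteqP; split => c /=; rewrite -!window_num_central ?leq_maxl ?leq_maxr//.
  by move=> [-> ->].
by move=> /andP.
Qed.

(** The sets containing every configuration that agrees with [c] on some central window form a
    filter. It converges to [c] in the product topology because it does so in each coordinate. *)
Lemma open_window (m : nat) (U : set (conf m)) (c : conf m) : open U -> U c ->
  exists n : nat, forall c' : borel_conf m,
    window_num c' (- n%:Z) n.*2 = window_num (c : borel_conf m) (- n%:Z) n.*2 -> U c'.
Proof.
move=> oU Uc.
pose F : set_system (conf m) := [set A | exists n : nat, forall c' : borel_conf m,
    window_num c' (- n%:Z) n.*2 = window_num (c : borel_conf m) (- n%:Z) n.*2 -> A c'].
have FF : Filter F.
  split.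
  - by exists 0%N.
  - move=> A B [n nA] [k kB]; exists (maxn n k) => c' E; split.
      by apply: nA; rewrite !(window_num_central _ (leq_maxl n k)) E.
    by apply: kB; rewrite !(window_num_central _ (leq_maxr n k)) E.
  - by move=> A B AB [n nA]; exists n => c' /nA /AB.
have Fc : F --> (c : conf m).
  apply/cvg_sup => i A; rewrite nbhsE => -[_ [[B _ <-] Bc] BA].
  (* The right end of a window is excluded, hence the successor. *)
  exists `|i|.+1 => c' E; apply: BA; rewrite /= (_ : c' i = c i)//.
  have Ei : i = - `|i|.+1%:Z + (absz (i + `|i|.+1%:Z))%:Z by lia.
  by rewrite Ei; apply: (window_num_inj E); lia.
by have [] := Fc U (open_nbhs_nbhs (conj oU Uc)) => n nU; exists n.
Qed.

Lemma measurable_window_sets (m : nat) :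
  @measurable _ (borel_conf m) = <<s @window_sets m >>.
Proof.
apply/seteqP; split; last first.
  apply: smallest_sub; first exact: sigma_algebra_measurable.
  by move=> _ [n [P ->]]; exact: measurable_window.
apply: smallest_sub; first exact: smallest_sigma_algebra.
move=> U oU.
(* [W n] collects the configurations whose window of radius [n] already forces membership in [U]. It
   is a window event, and countably many of them exhaust [U]. *)
pose W n := [set c : borel_conf m | `[< forall c' : borel_conf m,
    window_num c' (- n%:Z) n.*2 = window_num c (- n%:Z) n.*2 -> U c' >]].
have -> : U = \bigcup_n W n.
  apply/seteqP; split => [c Uc|c [n _ /= /asboolP]]; last by apply.
  by have [n nU] := open_window oU Uc; exists n => //; apply/asboolP.
apply: sigma_algebra_bigcup => n.
apply: sub_gen_smallest; exists n.
exists (fun a => `[< forall c' : borel_conf m,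
  window_num c' (- n%:Z) n.*2 = a -> U c' >]).
by [].
Qed.

Lemma window_sets_setT (m : nat) : @window_sets m setT.
Proof. by exists 0%N, xpredT; apply/seteqP. Qed.

(** * The Bernoulli measure of window events *)

Lemma window_num_surj (m : nat) (i : int) (n a : nat) : (a < m.+1 ^ n)%N ->
  exists c : borel_conf m, window_num c i n = a.
Proof.
elim: n a => [|n IH] a; first by case: a => // _; exists point.
rewrite expnSr => aM; have [|c cE] := IH (a %/ m.+1)%N; first by rewrite ltn_divLR.
exists (fun j => if j == i + n%:Z then inord (a %% m.+1) else c j).
rewrite window_numS eqxx inordK ?ltn_mod// (@eq_window_num _ _ c i i).
  by rewrite cE -divn_eq.
by move=> k kn; rewrite ifF//; apply/negbTE; lia.
Qed.

Lemma bernoulli_window1 (R : realType) (m : nat)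
    (mu : probability (borel_conf m) R) (i : int) (n a : nat) :
  uniform_bernoulli mu -> (a < m.+1 ^ n)%N ->
  mu [set c | window_num c i n = a] = ((m.+1 ^ n)%:R^-1)%:E.
Proof.
move=> mub aM; have [c cE] := window_num_surj i aM.
(* [uniform_bernoulli] speaks of nonempty words only; for the empty window the event is the whole
   space. *)
case: n aM cE => [|n] aM cE.
  rewrite expn0 invr1 -[RHS](probability_setT mu); congr (mu _).
  by apply/seteqP; split=> // c' _ /=; rewrite -cE.
pose w : seq (alphabet m) := mkseq (fun k : nat => c (i + k%:Z)) n.+1.
have sw : size w = n.+1 by rewrite size_mkseq.
rewrite natrX -[X in _ ^- X]sw -(mub i w)//.
congr (mu _); apply/seteqP; split => c'.
  move=> /= c'E k; rewrite sw => kn; rewrite nth_mkseq//.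
  exact: (@window_num_inj _ c' c i n.+1 (etrans c'E (esym cE))).
move=> c'E; apply: etrans cE; apply: eq_window_num => k kn.
by rewrite c'E ?sw// nth_mkseq.
Qed.

Lemma bernoulli_window (R : realType) (m : nat)
    (mu : probability (borel_conf m) R) (i : int) (n : nat) (P : pred nat) :
  uniform_bernoulli mu ->
  mu [set c | P (window_num c i n)] =
  ((\sum_(0 <= a < m.+1 ^ n) P a)%N%:R / (m.+1 ^ n)%:R)%:E.
Proof.
move=> mub.
(* The cutoff [N] lets finite additivity add one window value at a time. *)
have H N : (N <= m.+1 ^ n)%N ->
    mu [set c | P (window_num c i n) && (window_num c i n < N)%N] =
    ((\sum_(0 <= a < N) P a)%N%:R / (m.+1 ^ n)%:R)%:E.
  elim: N => [|N IH] NM.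
    rewrite big_nil mul0r (_ : [set _ | _] = set0) ?measure0//.
    by apply/seteqP; split => // c; rewrite /= ltn0 andbF.
  rewrite big_nat_recr//= natrD mulrDl EFinD -IH; last exact: ltnW.
  pose A := [set c : borel_conf m | P (window_num c i n) && (window_num c i n == N)].
  have -> : ((P N)%:R / (m.+1 ^ n)%:R)%:E = mu A.
    rewrite /A; case: (boolP (P N)) => PN.
      rewrite mul1r -(bernoulli_window1 i mub NM); congr (mu _).
      apply/seteqP; split => c /=; last by case/andP => _ /eqP.
      by move=> ->; rewrite PN eqxx.
    rewrite mul0r (_ : [set _ | _] = set0) ?measure0//.
    by apply/seteqP; split => // c /= /andP[+ /eqP E]; rewrite E (negbTE PN).
  rewrite -measureU//.
  - congr (mu _); apply/seteqP; split => c; rewrite /A /=.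
      by rewrite ltnS leq_eqVlt => /andP[-> /orP[->|->]]; [right|left].
    by move=> [] /andP[-> ?]; rewrite ltnS leq_eqVlt; apply/orP; [right|left].
  - exact: (measurable_window i n (fun a => P a && (a < N)%N)).
  - exact: (measurable_window i n (fun a => P a && (a == N)%N)).
  - apply/seteqP; split => // c [/= /andP[_ ltN] /andP[_ /eqP E]].
    by rewrite E ltnn in ltN.
rewrite -H//; congr (mu _); apply/seteqP; split => c /=.
  by move=> ->; rewrite window_num_lt.
by case/andP.
Qed.

(** * Extending setwise convergence from a pi-system *)

Lemma cvge_fin_dist (R : realType) (u : nat -> \bar R) (l : \bar R) :
  (forall t, u t \is a fin_num) -> l \is a fin_num ->
  u @ \oo --> l <->
  (forall e : R, 0 < e -> \forall t \near \oo, `|fine l - fine (u t)| <= e).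
Proof.
move=> uf lf; rewrite -{1}(fineK lf); split.
  by move=> /fine_cvgP[_ /cvgrPdist_le].
move=> H; apply/fine_cvgP; split; first exact: nearW.
exact/cvgrPdist_le.
Qed.

(** The sets on which convergence holds form a Dynkin system. Only countable disjoint unions need
    care: domination by the finite measure [mu] makes the tails of a union small uniformly in
    [t]. *)
Lemma measure_cvg_dynkin d (T : measurableType d) (R : realType)
    (G : set (set T)) (mu : probability T R)
    (nu : nat -> {measure set T -> \bar R}) (la : {measure set T -> \bar R}) :
  @measurable _ T = <<s G >> -> setI_closed G -> G setT ->
  (forall t A, measurable A -> (nu t A <= mu A)%E) ->
  (forall A, measurable A -> (la A <= mu A)%E) ->
  (forall A, G A -> nu ^~ A @ \oo --> la A) ->
  forall A, measurable A -> nu ^~ A @ \oo --> la A.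
Proof.
move=> mG GI GT numu lamu GP.
have muf A : measurable A -> mu A \is a fin_num by move=> mA; exact: fin_num_measure.
have nuf t A : measurable A -> nu t A \is a fin_num.
  move=> mA; rewrite ge0_fin_numE//; apply: (le_lt_trans (numu t A mA)).
  by rewrite -ge0_fin_numE// muf.
have laf A : measurable A -> la A \is a fin_num.
  move=> mA; rewrite ge0_fin_numE//; apply: (le_lt_trans (lamu A mA)).
  by rewrite -ge0_fin_numE// muf.
rewrite [X in forall A, X A -> _]mG.
apply: (dynkin_induction mG GI) => //; first exact: GP.
- move=> S mS cS.
  have -> : la (~` S) = (la setT - la S)%E.
    by rewrite -setTD measureD ?setTI// -ge0_fin_numE// laf.
  rewrite [X in X @ _ --> _](_ : _ = fun t => (nu t setT - nu t S)%E); last first.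
    by apply/funext => t; rewrite -setTD measureD ?setTI// -ge0_fin_numE// nuf.
  by apply: cvgeB => //; [rewrite fin_num_adde_defr// laf|exact: GP].
- move=> F mF tF cF.
  pose A n := \big[setU/set0]_(k < n) F k.
  have mA n : measurable (A n) by apply: bigsetU_measurable.
  have mU : measurable (\bigcup_k F k) by exact: bigcupT_measurable.
  have AU n : A n `<=` \bigcup_k F k.
    by rewrite /A -bigcup_mkord => x [k _ Fk]; exists k.
  have AS n : A n.+1 = A n `|` F n by rewrite /A big_ord_recr.
  have AF n : A n `&` F n = set0.
    apply/seteqP; split => // x []; rewrite /A -bigcup_mkord => -[k /= kn Fk Fn].
    by have := tF k n I I (ex_intro _ x (conj Fk Fn)) => E; rewrite E ltnn in kn.
  have muA : mu \o A @ \oo --> mu (\bigcup_k F k).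
    have UA : \bigcup_n A n = \bigcup_k F k.
      apply/seteqP; split => x [n _]; first exact: AU.
      by move=> Fx; exists n.+1 => //; rewrite AS; right.
    rewrite -UA; apply: nondecreasing_cvg_mu => //; first by rewrite UA.
    by apply/nondecreasing_seqP => n; apply/subsetPset; rewrite AS; left.
  have cA n : nu ^~ (A n) @ \oo --> la (A n).
    elim: n => [|n IH].
      rewrite /A big_ord0 measure0 (_ : nu ^~ set0 = cst 0%E); first exact: cvg_cst.
      by apply/funext => t; rewrite measure0.
    rewrite AS measureU// [X in X @ _ --> _](_ : _ =
      fun t => (nu t (A n) + nu t (F n))%E); last first.
      by apply/funext => t; rewrite measureU.
    by apply: cvgeD => //; rewrite fin_num_adde_defl// laf.
  have split_at (m : {measure set T -> \bar R}) n :
      (forall B, measurable B -> m B \is a fin_num) ->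
      fine (m (\bigcup_k F k)) =
      fine (m (A n)) + fine (m (\bigcup_k F k `\` A n)).
    move=> mf; rewrite -fineD ?mf//; last exact: measurableD.
    by rewrite (measureDI _ mU (mA n)) setIidr// addeC.
  apply/cvge_fin_dist => [t||e e0]; [exact: nuf|exact: laf|].
  have e30 : 0 < e / 3 by rewrite divr_gt0.
  (* For this [n] the part of the union outside [A n] has [mu]-mass at most [e / 3], and domination
     passes the bound on to [la] and to every [nu t]. *)
  have [n _ /(_ n (leqnn n)) /= muD] :=
    (cvge_fin_dist (fun n => muf _ (mA n)) (muf _ mU)).1 muA _ e30.
  have H := (cvge_fin_dist (fun t => nuf t _ (mA n)) (laf _ (mA n))).1 (cA n) _ e30.
  have mD : measurable (\bigcup_k F k `\` A n) by exact: measurableD.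
  rewrite (split_at mu n muf) addrAC subrr add0r in muD.
  near=> t.
  rewrite (split_at la n laf) (split_at (nu t) n (nuf t)).
  have laD : fine (la (\bigcup_k F k `\` A n)) <= e / 3.
    rewrite (le_trans _ (le_trans (ler_norm _) muD))// fine_le ?laf ?muf//.
    exact: lamu.
  have nuD : fine (nu t (\bigcup_k F k `\` A n)) <= e / 3.
    rewrite (le_trans _ (le_trans (ler_norm _) muD))// fine_le ?nuf ?muf//.
    exact: numu.
  have laD0 : 0 <= fine (la (\bigcup_k F k `\` A n)) by exact: fine_ge0.
  have nuD0 : 0 <= fine (nu t (\bigcup_k F k `\` A n)) by exact: fine_ge0.
  have : `|fine (la (A n)) - fine (nu t (A n))| <= e / 3 by near: t.
  by rewrite !ler_norml => /andP[? ?]; apply/andP; split; lra.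
Unshelve. all: by end_near.
Qed.

(** * Measurability and invariance *)

Lemma preimage_iter_window (p q : nat) (t : nat) (i : int) (k : nat)
    (P : pred nat) : (0 < p)%N -> (0 < q)%N ->
  iter t (F_pq p q) @^-1` [set c | P (window_num c i k)] =
  [set c | P (window_num c (i - t%:Z) (k + t.*2) %/ q ^ t.*2 %% (p * q) ^ k)%N].
Proof.
by move=> p0 q0; apply/seteqP; split => c /=; rewrite window_num_iter_F_pq.
Qed.

Lemma measurable_F_pq (p q : nat) : (0 < p)%N -> (0 < q)%N ->
  measurable_fun setT (F_pq p q).
Proof.
move=> p0 q0; apply: (measurability (@window_sets (p * q).-1)).
  exact: measurable_window_sets.
move=> _ [_ [n [P ->]] <-]; rewrite setTI -[F_pq p q]/(iter 1 (F_pq p q)).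
rewrite preimage_iter_window//.
exact: (measurable_window _ _
  (fun a => P (a %/ q ^ 2 %% (p * q) ^ n.*2)%N)).
Qed.

Lemma measurable_iter_F_pq (p q t : nat) : (0 < p)%N -> (0 < q)%N ->
  measurable_fun setT (iter t (F_pq p q)).
Proof.
move=> p0 q0; elim: t => [|t IH]; first exact: measurable_id.
exact: (measurableT_comp (measurable_F_pq p0 q0) IH).
Qed.

(* The library's measure instance on [pushforward] takes [mf] as an argument that
   canonical structure inference cannot supply. *)
Definition pushforward_measure d d' (T1 : measurableType d)
    (T2 : measurableType d') (R : realType) (m : {measure set T1 -> \bar R})
    (f : T1 -> T2) (mf : measurable_fun setT f) : {measure set T2 -> \bar R} :=
  measure_function_pushforward__canonical__measure_function_Measure m mf.

Lemma F_pq_preserving (R : realType) (p q : nat)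
    (mu : probability (borel_conf (p * q).-1) R) :
  (0 < p)%N -> (0 < q)%N -> uniform_bernoulli mu ->
  forall S, measurable S -> mu (F_pq p q @^-1` S) = mu S.
Proof.
move=> p0 q0 mub; have pq0 : (0 < p * q)%N by rewrite muln_gt0 p0.
have H A : window_sets A -> mu (F_pq p q @^-1` A) = mu A.
  move=> [n [P ->]]; rewrite -[F_pq p q]/(iter 1 (F_pq p q)).
  rewrite preimage_iter_window//.
  rewrite (bernoulli_window (- n%:Z - 1%:Z) (n.*2 + 1.*2)
    (fun a => P (a %/ q ^ 1.*2 %% (p * q) ^ n.*2)%N) mub).
  rewrite (bernoulli_window _ _ P mub) prednK//.
  (* The integers of the enlarged window make up exactly [p ^ 2] periods of the event, so no error
     arises. *)
  have -> : ((p * q) ^ (n.*2 + 1.*2) = p ^ 2 * ((p * q) ^ n.*2 * q ^ 2))%N.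
    by rewrite expnD (expnMn p q 2); ring.
  rewrite (sum_divmod_mul (fun a => P a : nat)) ?expn_gt0 ?q0//.
  congr EFin; rewrite !natrM; field.
  by rewrite !pnatr_eq0 -!lt0n !expn_gt0 pq0 p0 q0.
apply: (measure_unique (@window_sets (p * q).-1) (fun=> setT)
  (@measurable_window_sets _) (@setI_closed_window_sets _) _ _
  (pushforward_measure mu (measurable_F_pq p0 q0)) mu) => [_|||_].
- exact: window_sets_setT.
- exact: bigcup_const.
- exact: H.
- by rewrite [ltLHS](probability_setT mu) ltry.
Qed.

Lemma iter_F_pq_preserving (R : realType) (p q : nat)
    (mu : probability (borel_conf (p * q).-1) R) :
  (0 < p)%N -> (0 < q)%N -> uniform_bernoulli mu ->
  forall t S, measurable S -> mu (iter t (F_pq p q) @^-1` S) = mu S.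
Proof.
move=> p0 q0 mub; elim=> // t IH S mS.
rewrite -[RHS](F_pq_preserving p0 q0 mub mS) -[RHS]IH//.
by rewrite -[X in measurable X]setTI; exact: measurable_F_pq.
Qed.

(** * Mixing, first for window events and then for Borel sets *)

Lemma mixing_window (R : realType) (p q : nat)
    (mu : probability (borel_conf (p * q).-1) R) :
  (q < p)%N -> (0 < q)%N -> uniform_bernoulli mu ->
  forall U V, window_sets U -> window_sets V ->
  (fun t : nat => mu (iter t (F_pq p q) @^-1` U `&` V)) @ \oo --> (mu U * mu V)%E.
Proof.
move=> qp q0 mub _ _ [n [P ->]] [r [S ->]].
have p0 : (0 < p)%N by exact: ltn_trans qp.
have pq0 : (0 < p * q)%N by rewrite muln_gt0 p0.
set U := [set c | P _]; set V := [set c | S _].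
have mU : measurable U by exact: measurable_window.
have mV : measurable V by exact: measurable_window.
apply/cvge_fin_dist => [t||e e0].
- apply: fin_num_measure; apply: measurableI => //.
  by rewrite -[X in measurable X]setTI; exact: measurable_iter_F_pq.
- by rewrite fin_numM// fin_num_measure.
have z1 : `|q%:R / p%:R| < 1 :> R.
  by rewrite ger0_norm ?divr_ge0// ltr_pdivrMr ?ltr0n// mul1r ltr_nat.
have := cvg_geometric ((p * q) ^ (n + r))%:R z1.
move=> /cvgrPdist_le /(_ _ e0) H; near=> t.
have rt : (r <= t)%N by near: t; exact: nbhs_infty_ge.
have : ((p * q) ^ (n + r))%:R * (q%:R / p%:R) ^+ t <= e.
  by apply: le_trans (ler_norm _) _; rewrite -normrN -sub0r; near: t.
apply: le_trans.
(* Both events are read off the window of radius [n + t]; [b] is the number of its cells on either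
   side of the window of [V]. *)
pose b := (n + t - r)%N.
have -> : iter t (F_pq p q) @^-1` U `&` V = [set c |
    P (window_num c (- (n + t)%:Z) (n + t).*2 %/ q ^ t.*2 %% (p * q) ^ n.*2)%N &&
    S (window_num c (- (n + t)%:Z) (n + t).*2 %/ (p * q) ^ b %% (p * q) ^ r.*2)%N].
  rewrite preimage_iter_window// -doubleD PoszD opprD.
  apply/seteqP; split=> c; rewrite /V/= (@window_num_central _ c r (n + t)) ?(leq_trans rt)// ?leq_addl//.
    by rewrite -opprD -PoszD prednK// => -[-> ->].
  by rewrite -opprD -PoszD prednK// => /andP.
rewrite (bernoulli_window (- (n + t)%:Z) (n + t).*2
  (fun a => P (a %/ q ^ t.*2 %% (p * q) ^ n.*2)%N &&
  S (a %/ (p * q) ^ b %% (p * q) ^ r.*2)%N) mub).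
rewrite !(bernoulli_window _ _ _ mub) prednK//= distrC.
have -> : ((p * q) ^ (n + t).*2 = (p * q) ^ b * (p * q) ^ r.*2 * (p * q) ^ b)%N.
  by rewrite -!expnD; congr expn; rewrite /b; lia.
(* Here [Q = q ^ t.*2], [K = (p * q) ^ n.*2], [E = (p * q) ^ r.*2] and [L = e = (p * q) ^ b]. The
   error [K * Q / L] equals [(p * q) ^ (n + r) * (q / p) ^ t]. *)
apply: le_trans (joint_frequency_error _ _ _ _ _ _ _ _) _; rewrite ?expn_gt0 ?pq0 ?q0//.
rewrite ler_pdivrMr ?ltr0n ?expn_gt0 ?pq0//.
rewrite expr_div_n mulrAC mulrA ler_pdivlMr ?exprn_gt0 ?ltr0n//.
rewrite -!natrX -!natrM ler_nat -expnD (_ : n + r + b = n.*2 + t)%N; last by rewrite /b; lia.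
by rewrite -!addnn !expnD !expnMn eq_leq//; ring.
Unshelve. all: by end_near.
Qed.

Theorem theorem3 (R : realType) (p q : nat)
    (mu : probability (borel_conf (p * q).-1) R) :
  (q < p)%N -> (1 < q)%N -> coprime p q ->
  uniform_bernoulli mu ->
  [/\ measurable_fun setT (F_pq p q),
      (forall S : set (borel_conf (p * q).-1), measurable S ->
         mu (F_pq p q @^-1` S) = mu S) &
      (forall U V : set (borel_conf (p * q).-1), measurable U -> measurable V ->
         (fun t : nat => mu ((iter t (F_pq p q)) @^-1` U `&` V)) @ \oo
           --> (mu U * mu V)%E)].
Proof.
move=> qp q1 _ mub.
have q0 : (0 < q)%N by exact: ltnW.
have p0 : (0 < p)%N by exact: ltn_trans qp.
have mFt t A : measurable A -> measurable (iter t (F_pq p q) @^-1` A).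
  by move=> mA; rewrite -[X in measurable X]setTI; exact: measurable_iter_F_pq.
have mscale_le A B : measurable A -> measurable B ->
    ((fine (mu A))%:E * mu B <= mu B)%E.
  move=> mA mB; rewrite fineK ?fin_num_measure//.
  by rewrite -[leRHS]mul1e lee_wpmul2r// probability_le1.
split; [exact: measurable_F_pq | exact: F_pq_preserving |].
(* First extension: [V] stays a window event and [U] becomes Borel. Invariance under the iterates
   gives the domination by [mu]. *)
have mix_window V : window_sets V -> forall U, measurable U ->
    (fun t : nat => mu (iter t (F_pq p q) @^-1` U `&` V)) @ \oo
      --> ((fine (mu V))%:E * mu U)%E.
  move=> wV; have mV : measurable V by have [n [P ->]] := wV; exact: measurable_window.
  pose k := NngNum (fine_ge0 (measure_ge0 mu V)).
  apply: (@measure_cvg_dynkin _ _ _ (@window_sets (p * q).-1) mu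
    (fun t => pushforward_measure (mrestr mu mV) (measurable_iter_F_pq t p0 q0))
    (mscale k mu) (@measurable_window_sets _) (@setI_closed_window_sets _)
    (@window_sets_setT _)).
  - move=> t A mA; rewrite -[leRHS](iter_F_pq_preserving p0 q0 mub t mA).
    apply: (@le_measure _ _ _ mu); [apply/mem_set|apply/mem_set|].
    + by apply: measurableI => //; exact: mFt.
    + exact: mFt.
    + exact: subIsetl.
  - by move=> A mA; exact: mscale_le.
  - move=> A wA; have := mixing_window qp q0 mub wA wV.
    by rewrite muleC -[mu V]fineK ?fin_num_measure.
move=> U V mU; move: V.
pose k := NngNum (fine_ge0 (measure_ge0 mu U)).
move=> V mV; rewrite -[mu U]fineK ?fin_num_measure//.
under eq_fun do rewrite setIC.
(* Second extension: [U] is a fixed Borel set and [V] varies. The measures are now restrictions of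
   [mu] to the preimages of [U], hence dominated by [mu]. *)
move: V mV; apply: (@measure_cvg_dynkin _ _ _ (@window_sets (p * q).-1) mu
  (fun t => mrestr mu (mFt t U mU))
  (mscale k mu) (@measurable_window_sets _) (@setI_closed_window_sets _)
  (@window_sets_setT _)).
- move=> t A mA; apply: (@le_measure _ _ _ mu); [apply/mem_set|apply/mem_set|].
  + by apply: measurableI => //; exact: mFt.
  + exact: mA.
  + exact: subIsetl.
- by move=> A mA; exact: mscale_le.
- move=> A wA.
  have mA : measurable A by have [n [P ->]] := wA; exact: measurable_window.
  have := mix_window A wA U mU; rewrite fineK ?fin_num_measure// muleC.
  by rewrite -[mu U]fineK ?fin_num_measure//; under eq_fun do rewrite setIC.
Qed.
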